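(* Consider magmads on the category of sets. Every commutative monad (i.e. a commutative magmad that is a monad) is a left-exchanging magmad. Not every commutative magmad is a left-exchanging magmad.
   Context: Magmad on sets: an endofunctor $T$ with natural transformations $\eta_X\colon X\to TX$ and $\mu_X\colon TTX\to TX$ such that $\mu_X\circ\eta_{TX}=\mathrm{id}_{TX}=\mu_X\circ T(\eta_X)$. A monad is a magmad that also satisfies $\mu_X\circ T\mu_X=\mu_X\circ\mu_{TX}$. Every endofunctor on sets has canonical strengths $\psi_\ell\colon X\times TY\to T(X\times Y)$, $\psi_\ell(x,t)=T(y\mapsto(x,y))(t)$, and $\psi_r\colon TX\times Y\to T(X\times Y)$, $\psi_r(t,y)=T(x\mapsto(x,y))(t)$. A magmad is commutative if the two maps $TX\times TY\to T(X\times Y)$ given by $\mu\circ T(\psi_r)\circ\psi_\ell$ (through $T(TX\times Y)$) and $\mu\circ T(\psi_\ell)\circ\psi_r$ (through $T(X\times TY)$) are equal; the common value is denoted $\psi$. A left-exchanging magmad is a commutative magmad such that, moreover, the following equations of maps $T(TX\times TY)\to T(X\times Y)$ hold for all $X,Y$: (1) $\mu\circ T(\psi)=\mu\circ T(\psi_\ell)\circ\mu\circ T(\psi_r)$, the right-hand side passing through $TT(X\times TY)$, $T(X\times TY)$, $TT(X\times Y)$; (2) $\mu\circ T(\psi)=\mu\circ T(\psi_r)\circ\mu\circ T(\psi_\ell)$, the right-hand side passing through $TT(TX\times Y)$, $T(TX\times Y)$, $TT(X\times Y)$. *)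

(* Defs.v *)
From mathcomp Require Import ssreflect ssrfun ssrbool.

(* The category of sets is rendered as the category whose objects are the     *)
(* types of a fixed universe and whose morphisms are Rocq functions; equality *)
(* of morphisms is equality of functions (functional extensionality is        *)
(* assumed in proofs).                                                        *)

Record endofunctor := Endofunctor {
  fobj :> Type -> Type;
  fmap : forall X Y : Type, (X -> Y) -> fobj X -> fobj Y;
  fmap_id : forall X : Type, fmap X X id = id;
  fmap_comp : forall (X Y Z : Type) (g : Y -> Z) (f : X -> Y),
    fmap X Z (g \o f) = fmap Y Z g \o fmap X Y f }.

Arguments fmap T {X Y} f _ : rename.

Record magmad := Magmad {
  mfunctor :> endofunctor;
  eta : forall X : Type, X -> mfunctor X;
  mu : forall X : Type, mfunctor (mfunctor X) -> mfunctor X;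
  eta_natural : forall (X Y : Type) (f : X -> Y),
    fmap mfunctor f \o eta X = eta Y \o f;
  mu_natural : forall (X Y : Type) (f : X -> Y),
    fmap mfunctor f \o mu X = mu Y \o fmap mfunctor (fmap mfunctor f);
  mu_eta : forall X : Type, mu X \o eta (mfunctor X) = id;
  mu_fmap_eta : forall X : Type, mu X \o fmap mfunctor (eta X) = id }.

Definition is_monad (T : magmad) : Prop :=
  forall X : Type, mu T X \o fmap T (mu T X) = mu T X \o mu T (T X).

Definition strength_l (T : endofunctor) (X Y : Type) (p : X * T Y) : T (X * Y)%type :=
  fmap T (fun y => (p.1, y)) p.2.

Definition strength_r (T : endofunctor) (X Y : Type) (p : T X * Y) : T (X * Y)%type :=
  fmap T (fun x => (x, p.2)) p.1.

Definition psi_lr (T : magmad) (X Y : Type) : T X * T Y -> T (X * Y)%type :=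
  mu T (X * Y) \o fmap T (strength_r T X Y) \o strength_l T (T X) Y.

Definition psi_rl (T : magmad) (X Y : Type) : T X * T Y -> T (X * Y)%type :=
  mu T (X * Y) \o fmap T (strength_l T X Y) \o strength_r T X (T Y).

Definition commutative_magmad (T : magmad) : Prop :=
  forall X Y : Type, psi_lr T X Y = psi_rl T X Y.

(* The map psi of a commutative magmad is the common value of [psi_lr] and    *)
(* [psi_rl]; it is only used together with [commutative_magmad].              *)
Definition psi (T : magmad) (X Y : Type) : T X * T Y -> T (X * Y)%type :=
  psi_lr T X Y.

Definition left_exchanging (T : magmad) : Prop :=
  [/\ commutative_magmad T,
      forall X Y : Type,
        mu T (X * Y) \o fmap T (psi T X Y) =
        mu T (X * Y) \o fmap T (strength_l T X Y)
          \o mu T (X * T Y) \o fmap T (strength_r T X (T Y))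
    & forall X Y : Type,
        mu T (X * Y) \o fmap T (psi T X Y) =
        mu T (X * Y) \o fmap T (strength_r T X Y)
          \o mu T (T X * Y) \o fmap T (strength_l T (T X) Y)].

(* Main.v *)
Require Import Defs.
From mathcomp Require Import ssreflect ssrfun ssrbool.
From mathcomp Require Import ssrnat.
From Stdlib Require Import FunctionalExtensionality.

(** For a monad, Kleisli extension [f |-> mu \o fmap f] preserves Kleisli
    composition ([kleisli_extension_comp]).  The two sides of an exchange
    equation are the extension of a Kleisli composite of strengths and the
    composite of their extensions: equation (1) is the instance for [psi_rl],
    equation (2) the one for [psi_lr], and commutativity lets both be read as
    statements about [psi].

    Without associativity, take the writer magmad [X |-> M * X] of a set [M]
    with a binary operation and a two-sided unit.  On the [M]-components, the
    two candidates for [psi] send [(m, n)] to [n * m] and [m * n], so this magmad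
    is commutative when the operation is, whereas exchange equation (1) sends
    [(k, m, n)] to [k * (n * m)] on one side and to [(k * m) * n] on the other.
    Hence every commutative, unital, non-associative operation gives a
    counterexample; the distance [|m - n|] on the natural numbers is one. *)

(** The monad law takes the multiplication under [T] outside, and naturality
    then moves it past [fmap T g]. *)
Lemma kleisli_extension_comp (T : magmad) (X Y Z : Type)
    (f : X -> T Y) (g : Y -> T Z) :
  is_monad T ->
  mu T Z \o fmap T (mu T Z \o fmap T g \o f) =
  mu T Z \o fmap T g \o mu T Y \o fmap T f.
Proof.
move=> monadT.
rewrite (fmap_comp T _ _ _ (mu T Z \o fmap T g) f).
rewrite (fmap_comp T _ _ _ (mu T Z) (fmap T g)).
apply: functional_extensionality => t /=.
have /= -> := equal_f (monadT Z) (fmap T (fmap T g) (fmap T f t)).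
by have /= -> := equal_f (mu_natural T _ _ g) (fmap T f t).
Qed.

Lemma commutative_monad_left_exchanging (T : magmad) :
  is_monad T -> commutative_magmad T -> left_exchanging T.
Proof.
move=> monadT commT; split=> // X Y; last exact: kleisli_extension_comp.
by rewrite /psi commT; exact: kleisli_extension_comp.
Qed.

Section Writer.

Variables (M : Type) (op : M -> M -> M) (e : M).

Definition writer_map (X Y : Type) (f : X -> Y) (p : M * X) : M * Y :=
  (p.1, f p.2).

Lemma writer_map_id (X : Type) : writer_map X X id = id.
Proof. by apply: functional_extensionality => -[]. Qed.

Definition writer_functor : endofunctor :=
  Endofunctor (fun X => (M * X)%type) writer_map writer_map_id
    (fun _ _ _ _ _ => erefl).

Definition writer_eta (X : Type) (x : X) : writer_functor X := (e, x).

Definition writer_mu (X : Type) (p : writer_functor (writer_functor X)) :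
  writer_functor X := (op p.1 p.2.1, p.2.2).

Hypotheses (op1m : left_id e op) (opm1 : right_id e op).

Lemma writer_mu_eta (X : Type) :
  writer_mu X \o writer_eta (writer_functor X) = id.
Proof.
by apply: functional_extensionality => -[m x]; rewrite /writer_mu /= op1m.
Qed.

Lemma writer_mu_map_eta (X : Type) :
  writer_mu X \o fmap writer_functor (writer_eta X) = id.
Proof.
by apply: functional_extensionality => -[m x]; rewrite /writer_mu /= opm1.
Qed.

Definition writer_magmad : magmad :=
  Magmad writer_functor writer_eta writer_mu (fun _ _ _ => erefl)
    (fun _ _ _ => erefl) writer_mu_eta writer_mu_map_eta.

Lemma writer_commutative : commutative op -> commutative_magmad writer_magmad.
Proof.
move=> opC X Y; apply: functional_extensionality => -[[m x] [n y]].
by rewrite /psi_lr /psi_rl /= /writer_mu /= opC.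
Qed.

(** Exchange equation (1) at [X = Y = unit] reads [k * (n * m) = (k * m) * n];
    commutativity turns its left-hand side into [k * (m * n)]. *)
Lemma writer_left_exchanging_assoc :
  commutative op -> left_exchanging writer_magmad -> associative op.
Proof.
move=> opC [_ exch _] k m n.
have /(congr1 (fun h => (h (k, ((m, tt), (n, tt)))).1)) := exch unit unit.
by rewrite /= (opC n m).
Qed.

End Writer.

Definition nat_dist (m n : nat) : nat := (m - n) + (n - m).

Lemma nat_dist0n : left_id 0 nat_dist.
Proof. by move=> n; rewrite /nat_dist sub0n subn0. Qed.

Lemma nat_distn0 : right_id 0 nat_dist.
Proof. by move=> n; rewrite /nat_dist sub0n subn0 addn0. Qed.

Lemma nat_distC : commutative nat_dist.
Proof. by move=> m n; exact: addnC. Qed.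

(** [|1 - |1 - 2|| = 0], whereas [||1 - 1| - 2| = 2]. *)
Lemma nat_dist_not_assoc : ~ associative nat_dist.
Proof. by move=> /(_ 1 1 2). Qed.

Theorem proposition5p9 :
  (forall T : magmad, is_monad T -> commutative_magmad T -> left_exchanging T) /\
  ~ (forall T : magmad, commutative_magmad T -> left_exchanging T).
Proof.
split; first exact: commutative_monad_left_exchanging.
move=> all_exch; apply: nat_dist_not_assoc.
apply: (writer_left_exchanging_assoc _ _ _ nat_dist0n nat_distn0 nat_distC).
exact/all_exch/writer_commutative/nat_distC.
Qed.
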